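(* Let the Hopf algebra $\mathcal{H}_1$ act on an associative algebra $A$ over $\mathbb{C}$. Then $RC_1=-X\otimes 2Y+2Y\otimes X+\delta_1Y\otimes 2Y$, viewed as the bilinear map $$RC_1(a,b)=-X(a)\,2Y(b)+2Y(a)\,X(b)+\delta_1Y(a)\,2Y(b)$$ on $A$, defines a noncommutative Poisson structure on $A$.
   Context: The Hopf algebra $\mathcal{H}_1$ is the universal enveloping algebra of the Lie algebra with basis $X,Y,\delta_n$ ($n\ge1$) and brackets $[Y,X]=X$, $[X,\delta_n]=\delta_{n+1}$, $[Y,\delta_n]=n\delta_n$, $[\delta_n,\delta_m]=0$. Its coproduct is determined by $\Delta Y=Y\otimes1+1\otimes Y$, $\Delta\delta_1=\delta_1\otimes1+1\otimes\delta_1$, $\Delta X=X\otimes1+1\otimes X+\delta_1\otimes Y$; its antipode by $S(Y)=-Y$, $S(\delta_1)=-\delta_1$, $S(X)=-X+\delta_1Y$. An action of $\mathcal{H}_1$ on $A$ makes $A$ a module algebra: $h(ab)=\sum h_{(1)}(a)h_{(2)}(b)$. A (noncommutative) Poisson structure on an associative algebra $A$ (Block, Getzler, Xu) is a class $[\Pi]\in H^2(A,A)$ in Hochschild cohomology such that the cohomology class of the Gerstenhaber bracket $[\Pi,\Pi]$ vanishes. Thus a bilinear map $\Pi$ defines one if it is a Hochschild 2-cocycle, i.e. $a\Pi(b,c)-\Pi(ab,c)+\Pi(a,bc)-\Pi(a,b)c=0$, and there is a bilinear map $B:A\times A\to A$ with $$aB(b,c)-B(ab,c)+B(a,bc)-B(a,b)c=\Pi(\Pi(a,b),c)-\Pi(a,\Pi(b,c))\quad\text{for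 all }a,b,c\in A.$$ *)

(* Defs.v *)
From HB Require Import structures.
From mathcomp Require Import all_boot all_algebra sesquilinear.
From mathcomp Require Import boolp reals complex.

Set Implicit Arguments.
Unset Strict Implicit.
Unset Printing Implicit Defensive.

Import GRing.Theory.
Local Open Scope ring_scope.
Local Open Scope quotient_scope.

Definition commutator (B : pzRingType) (x y : B) : B := x * y - y * x.

(** A finite formal sum of pure tensors is a sequence of pairs; two formal sums
    are the same tensor when every bilinear map takes the same value on them. *)
Section TensorSpace.
Variables (K : fieldType) (V W : lmodType K).

Definition tsum (U : zmodType) (beta : V -> W -> U) (s : seq (V * W)) : U :=
  \sum_(p <- s) beta p.1 p.2.

Definition tens_rel (s t : seq (V * W)) : Prop :=
  forall (U : lmodType K) (beta : {bilinear V -> W -> U}),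
    tsum beta s = tsum beta t.

Definition tens_eqb : rel (seq (V * W)) := fun s t => `[< tens_rel s t >].

Lemma tens_eqb_refl : reflexive tens_eqb.
Proof. by move=> s; apply/asboolP. Qed.

Lemma tens_eqb_sym : symmetric tens_eqb.
Proof. by move=> s t; apply/asboolP/asboolP => h U beta; rewrite h. Qed.

Lemma tens_eqb_trans : transitive tens_eqb.
Proof.
move=> t s u /asboolP h /asboolP h'; apply/asboolP => U beta.
by rewrite h h'.
Qed.

Definition tens_equiv : equiv_rel (seq (V * W)) :=
  EquivRel tens_eqb tens_eqb_refl tens_eqb_sym tens_eqb_trans.

Definition tens : Type := {eq_quot tens_equiv}.
HB.instance Definition _ := Choice.on tens.
HB.instance Definition _ := EqQuotient.on tens.

Definition tens_of (s : seq (V * W)) : tens := \pi_tens s.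
Definition tens_repr (t : tens) : seq (V * W) := repr t.

Lemma tens_ofK t : tens_of (tens_repr t) = t.
Proof. exact: reprK. Qed.

Lemma tens_ofP s t : tens_of s = tens_of t <-> tens_rel s t.
Proof. by split=> [/eqquotP /asboolP //|h]; apply/eqquotP/asboolP. Qed.

Definition tens_lift (U : zmodType) (beta : V -> W -> U) (t : tens) : U :=
  tsum beta (tens_repr t).

Lemma tens_lift_of (U : lmodType K) (beta : {bilinear V -> W -> U}) s :
  tens_lift beta (tens_of s) = tsum beta s.
Proof. by apply/(proj1 (tens_ofP _ _))/tens_ofK. Qed.

Lemma tensP (t t' : tens) :
  (forall (U : lmodType K) (beta : {bilinear V -> W -> U}),
     tens_lift beta t = tens_lift beta t') -> t = t'.
Proof. by move=> h; rewrite -[t]tens_ofK -[t']tens_ofK; apply/tens_ofP => U b; exact: h. Qed.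

Definition pure (v : V) (w : W) : tens := tens_of [:: (v, w)].
Definition tens_zero : tens := tens_of [::].
Definition tens_add (t t' : tens) : tens :=
  tens_of (tens_repr t ++ tens_repr t').
Definition tens_scale (a : K) (t : tens) : tens :=
  tens_of [seq (a *: p.1, p.2) | p <- tens_repr t].
Definition tens_opp (t : tens) : tens := tens_scale (-1) t.

Section Lift.
Variables (U : lmodType K) (beta : {bilinear V -> W -> U}).

Lemma tens_lift_pure v w : tens_lift beta (pure v w) = beta v w.
Proof. by rewrite tens_lift_of /tsum big_seq1. Qed.

Lemma tens_lift0_ : tens_lift beta tens_zero = 0.
Proof. by rewrite tens_lift_of /tsum big_nil. Qed.

Lemma tens_liftD_ t t' :
  tens_lift beta (tens_add t t') = tens_lift beta t + tens_lift beta t'.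
Proof. by rewrite tens_lift_of /tsum big_cat. Qed.

Lemma tens_liftZ_ a t : tens_lift beta (tens_scale a t) = a *: tens_lift beta t.
Proof.
rewrite tens_lift_of /tsum big_map scaler_sumr.
by apply: eq_bigr => p _ /=; rewrite linearZl_LR.
Qed.
End Lift.

Lemma tens_addA : associative tens_add.
Proof. by move=> *; apply: tensP => U b; rewrite !tens_liftD_ addrA. Qed.
Lemma tens_addC : commutative tens_add.
Proof. by move=> *; apply: tensP => U b; rewrite !tens_liftD_ addrC. Qed.
Lemma tens_add0 : left_id tens_zero tens_add.
Proof. by move=> *; apply: tensP => U b; rewrite !tens_liftD_ tens_lift0_ add0r. Qed.
Lemma tens_addN : left_inverse tens_zero tens_opp tens_add.
Proof.
by move=> *; apply: tensP => U b;
   rewrite tens_liftD_ tens_liftZ_ tens_lift0_ scaleN1r addNr.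
Qed.
HB.instance Definition _ :=
  GRing.isZmodule.Build tens tens_addA tens_addC tens_add0 tens_addN.

Lemma tens_scaleA a b t : tens_scale a (tens_scale b t) = tens_scale (a * b) t.
Proof. by apply: tensP => U be; rewrite !tens_liftZ_ scalerA. Qed.
Lemma tens_scale1 : left_id 1 tens_scale.
Proof. by move=> t; apply: tensP => U be; rewrite tens_liftZ_ scale1r. Qed.
Lemma tens_scaleDr : right_distributive tens_scale +%R.
Proof.
by move=> *; apply: tensP => U b;
   rewrite !(tens_liftZ_, tens_liftD_) scalerDr.
Qed.
Lemma tens_scaleDl t : {morph tens_scale^~ t : a b / a + b}.
Proof.
by move=> *; apply: tensP => U b;
   rewrite !(tens_liftZ_, tens_liftD_) scalerDl.
Qed.
HB.instance Definition _ := GRing.Zmodule_isLmodule.Build K tens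
  tens_scaleA tens_scale1 tens_scaleDr tens_scaleDl.

Lemma tens_lift_linear (U : lmodType K) (beta : {bilinear V -> W -> U}) :
  linear (tens_lift beta).
Proof. by move=> a t t'; rewrite tens_liftD_ tens_liftZ_. Qed.
HB.instance Definition _ (U : lmodType K) (beta : {bilinear V -> W -> U}) :=
  GRing.isLinear.Build K tens U *:%R (tens_lift beta) (tens_lift_linear beta).

Lemma pure_bilinear : bilinear_for
  (GRing.Scale.Law.clone _ _ *:%R _) (GRing.Scale.Law.clone _ _ *:%R _) pure.
Proof.
split=> [w|v] a x y; apply: tensP => U b.
  by rewrite linearP /= !tens_lift_pure linearPl.
by rewrite linearP /= !tens_lift_pure linearPr.
Qed.
HB.instance Definition _ :=
  bilinear_isBilinear.Build K V W tens _ _ pure pure_bilinear.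

Lemma tens_sum t : t = \sum_(p <- tens_repr t) pure p.1 p.2.
Proof.
apply: tensP => U b; rewrite linear_sum /=.
by under eq_bigr do rewrite tens_lift_pure.
Qed.

Lemma tens_ind (P : tens -> Prop) :
  P 0 -> (forall v w t, P t -> P (pure v w + t)) -> forall t, P t.
Proof.
move=> P0 PD t; rewrite (tens_sum t).
by elim: (tens_repr t) => [|p s IH]; rewrite ?big_nil // big_cons; apply: PD.
Qed.

End TensorSpace.

Section TensorAlgebra.
Variables (K : fieldType) (H : algType K).
Local Notation T := (tens H H).

Definition tens_mul (s t : T) : T :=
  tens_of [seq (p.1 * q.1, p.2 * q.2) | p <- tens_repr s, q <- tens_repr t].
Definition tens_one : T := pure 1 1.

Section Shift.
Variables (U : lmodType K) (beta : {bilinear H -> H -> U}) (a b : H).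

Definition shiftl (x y : H) : U := beta (a * x) (b * y).
Definition shiftr (x y : H) : U := beta (x * a) (y * b).

Lemma shiftl_bilinear : bilinear_for
  (GRing.Scale.Law.clone _ _ *:%R _) (GRing.Scale.Law.clone _ _ *:%R _) shiftl.
Proof.
split=> [u|u] c x y; rewrite /shiftl mulrDr -scalerAr ?linearPl ?linearPr //.
Qed.
HB.instance Definition _ :=
  bilinear_isBilinear.Build K H H U _ _ shiftl shiftl_bilinear.

Lemma shiftr_bilinear : bilinear_for
  (GRing.Scale.Law.clone _ _ *:%R _) (GRing.Scale.Law.clone _ _ *:%R _) shiftr.
Proof.
split=> [u|u] c x y; rewrite /shiftr mulrDl -scalerAl ?linearPl ?linearPr //.
Qed.
HB.instance Definition _ :=
  bilinear_isBilinear.Build K H H U _ _ shiftr shiftr_bilinear.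
End Shift.

Lemma tens_lift_mull (U : lmodType K) (beta : {bilinear H -> H -> U}) s t :
  tens_lift beta (tens_mul s t) =
  \sum_(p <- tens_repr s) tens_lift (shiftl beta p.1 p.2) t.
Proof. by rewrite tens_lift_of /tsum big_allpairs_dep. Qed.

Lemma tens_lift_mulr (U : lmodType K) (beta : {bilinear H -> H -> U}) s t :
  tens_lift beta (tens_mul s t) =
  \sum_(p <- tens_repr t) tens_lift (shiftr beta p.1 p.2) s.
Proof. by rewrite tens_lift_of /tsum big_allpairs_dep exchange_big. Qed.

Lemma tens_mulDl : left_distributive tens_mul +%R.
Proof.
move=> s s' t; apply: tensP => U b; rewrite linearD /= !tens_lift_mulr -big_split.
by apply: eq_bigr => p _; rewrite linearD.
Qed.

Lemma tens_mulDr : right_distributive tens_mul +%R.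
Proof.
move=> s t t'; apply: tensP => U b; rewrite linearD /= !tens_lift_mull -big_split.
by apply: eq_bigr => p _; rewrite linearD.
Qed.

Lemma tens_mulZl a s t : a *: tens_mul s t = tens_mul (a *: s) t.
Proof.
apply: tensP => U b; rewrite linearZ /= !tens_lift_mulr scaler_sumr.
by apply: eq_bigr => p _; rewrite linearZ.
Qed.

Lemma tens_mulZr a s t : a *: tens_mul s t = tens_mul s (a *: t).
Proof.
apply: tensP => U b; rewrite linearZ /= !tens_lift_mull scaler_sumr.
by apply: eq_bigr => p _; rewrite linearZ.
Qed.

Lemma tens_mul0l t : tens_mul 0 t = 0.
Proof. by apply: (addIr (tens_mul 0 t)); rewrite -tens_mulDl !add0r. Qed.

Lemma tens_mul0r t : tens_mul t 0 = 0.
Proof. by apply: (addIr (tens_mul t 0)); rewrite -tens_mulDr !add0r. Qed.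

Lemma tens_mul_pure a b c d :
  tens_mul (pure a b) (pure c d) = pure (a * c) (b * d).
Proof.
apply: tensP => U be; rewrite tens_lift_pure tens_lift_mull.
under eq_bigr do rewrite tens_lift_pure /shiftl.
exact: (tens_lift_pure (shiftr be c d)).
Qed.

Lemma tens_mul1l : left_id tens_one tens_mul.
Proof.
elim/tens_ind=> [|v w t IH]; first exact: tens_mul0r.
by rewrite tens_mulDr IH tens_mul_pure !mul1r.
Qed.

Lemma tens_mul1r : right_id tens_one tens_mul.
Proof.
elim/tens_ind=> [|v w t IH]; first exact: tens_mul0l.
by rewrite tens_mulDl IH tens_mul_pure !mulr1.
Qed.

Lemma tens_mulA : associative tens_mul.
Proof.
elim/tens_ind=> [s t|v w r IH s t]; first by rewrite !tens_mul0l.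
rewrite !tens_mulDl IH; congr (_ + _).
elim/tens_ind: s => [|v' w' s IH']; first by rewrite !(tens_mul0l, tens_mul0r).
rewrite !(tens_mulDl, tens_mulDr) IH' {IH'}; congr (_ + _).
elim/tens_ind: t => [|v'' w'' t IH'']; first by rewrite !tens_mul0r.
by rewrite !tens_mulDr IH'' !tens_mul_pure !mulrA.
Qed.

Let algmul (x y : H) : H := x * y.

Let algmul_bilinear : bilinear_for
  (GRing.Scale.Law.clone _ _ *:%R _) (GRing.Scale.Law.clone _ _ *:%R _) algmul.
Proof.
split=> u c x y /=; first by rewrite /algmul mulrDl scalerAl.
by rewrite /algmul mulrDr scalerAr.
Qed.
#[local] HB.instance Definition _ :=
  bilinear_isBilinear.Build K H H H _ _ algmul algmul_bilinear.

Lemma tens_one_neq0 : tens_one != 0.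
Proof.
apply/eqP => h; suff : 1 * 1 = 0 :> H by move/eqP; rewrite mulr1 oner_eq0.
rewrite -[LHS]/(algmul 1 1) -[LHS](tens_lift_pure algmul).
by rewrite -/tens_one h linear0.
Qed.

HB.instance Definition _ := GRing.Zmodule_isNzRing.Build T
  tens_mulA tens_mul1l tens_mul1r tens_mulDl tens_mulDr tens_one_neq0.
HB.instance Definition _ := GRing.Lmodule_isLalgebra.Build K T tens_mulZl.
HB.instance Definition _ := GRing.Lalgebra_isAlgebra.Build K T tens_mulZr.

Lemma pureM (a b c d : H) :
  pure a b * pure c d = pure (a * c) (b * d) :> tens H H.
Proof. exact: tens_mul_pure. Qed.

End TensorAlgebra.

(** [Gdelta n] stands for the basis element delta_(n+1) of the Lie algebra. *)
Inductive gen := GX | GY | Gdelta of nat.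

Definition gen_code (g : gen) : option (option nat) :=
  match g with GX => None | GY => Some None | Gdelta n => Some (Some n) end.
Definition gen_decode (c : option (option nat)) : gen :=
  match c with None => GX | Some None => GY | Some (Some n) => Gdelta n end.
Lemma gen_codeK : cancel gen_code gen_decode. Proof. by case. Qed.
HB.instance Definition _ := Countable.copy gen (can_type gen_codeK).

Record lie_relations (B : pzRingType) (g : gen -> B) : Prop := LieRelations {
  lie_YX : commutator (g GY) (g GX) = g GX;
  lie_Xdelta : forall n, commutator (g GX) (g (Gdelta n)) = g (Gdelta n.+1);
  lie_Ydelta : forall n, commutator (g GY) (g (Gdelta n)) = g (Gdelta n) *+ n.+1;
  lie_deltadelta :
    forall n m, commutator (g (Gdelta n)) (g (Gdelta m)) = 0 }.

(** The universal enveloping algebra of the Lie algebra with basis [gen]: linear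
    combinations of words in the basis, two of them being the same element when
    they take the same value in every unital algebra in which the basis is
    interpreted compatibly with the brackets. *)
Section EnvelopingAlgebra.
Variable K : fieldType.

Definition lincomb : Type := seq (K * seq gen).

Definition word_eval (B : algType K) (g : gen -> B) (s : lincomb) : B :=
  \sum_(p <- s) p.1 *: \prod_(x <- p.2) g x.

Definition h1_rel (s t : lincomb) : Prop :=
  forall (B : algType K) (g : gen -> B),
    lie_relations g -> word_eval g s = word_eval g t.

Definition h1_eqb : rel lincomb := fun s t => `[< h1_rel s t >].

Lemma h1_eqb_refl : reflexive h1_eqb.
Proof. by move=> s; apply/asboolP. Qed.

Lemma h1_eqb_sym : symmetric h1_eqb.
Proof. by move=> s t; apply/asboolP/asboolP => h B g hg; rewrite h. Qed.

Lemma h1_eqb_trans : transitive h1_eqb.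
Proof.
move=> t s u /asboolP h /asboolP h'; apply/asboolP => B g hg.
by rewrite h ?h'.
Qed.

Definition h1_equiv : equiv_rel lincomb :=
  EquivRel h1_eqb h1_eqb_refl h1_eqb_sym h1_eqb_trans.

Definition H1 : Type := {eq_quot h1_equiv}.
HB.instance Definition _ := Choice.on H1.
HB.instance Definition _ := EqQuotient.on H1.

Definition h1_of (s : lincomb) : H1 := \pi_H1 s.
Definition h1_repr (h : H1) : lincomb := repr h.

Lemma h1_ofK h : h1_of (h1_repr h) = h.
Proof. exact: reprK. Qed.

Lemma h1_ofP s t : h1_of s = h1_of t <-> h1_rel s t.
Proof. by split=> [/eqquotP /asboolP //|h]; apply/eqquotP/asboolP. Qed.

(* The universal property: an algebra morphism when [g] satisfies
   [lie_relations], see [h1_liftE]. *)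
Definition h1_lift (B : algType K) (g : gen -> B) (h : H1) : B :=
  word_eval g (h1_repr h).

Lemma h1_lift_of (B : algType K) (g : gen -> B) s :
  lie_relations g -> h1_lift g (h1_of s) = word_eval g s.
Proof. by move=> hg; apply: (proj1 (h1_ofP _ _) (h1_ofK _)). Qed.

Lemma h1P (h k : H1) :
  (forall (B : algType K) (g : gen -> B),
     lie_relations g -> h1_lift g h = h1_lift g k) -> h = k.
Proof.
by move=> hk; rewrite -[h]h1_ofK -[k]h1_ofK; apply/h1_ofP => B g; exact: hk.
Qed.

Definition h1_gen (x : gen) : H1 := h1_of [:: (1, [:: x])].
Definition h1_zero : H1 := h1_of [::].
Definition h1_one : H1 := h1_of [:: (1, [::])].
Definition h1_add (h k : H1) : H1 := h1_of (h1_repr h ++ h1_repr k).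
Definition h1_scale (a : K) (h : H1) : H1 :=
  h1_of [seq (a * p.1, p.2) | p <- h1_repr h].
Definition h1_opp (h : H1) : H1 := h1_scale (-1) h.
Definition h1_mul (h k : H1) : H1 :=
  h1_of [seq (p.1 * q.1, p.2 ++ q.2) | p <- h1_repr h, q <- h1_repr k].

Section Lift.
Variables (B : algType K) (g : gen -> B) (hg : lie_relations g).

Lemma h1_lift_gen x : h1_lift g (h1_gen x) = g x.
Proof. by rewrite h1_lift_of // /word_eval !big_seq1 scale1r. Qed.
Lemma h1_lift_zero : h1_lift g h1_zero = 0.
Proof. by rewrite h1_lift_of // /word_eval big_nil. Qed.
Lemma h1_lift_one : h1_lift g h1_one = 1.
Proof. by rewrite h1_lift_of // /word_eval big_seq1 big_nil scale1r. Qed.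
Lemma h1_lift_add h k : h1_lift g (h1_add h k) = h1_lift g h + h1_lift g k.
Proof. by rewrite h1_lift_of // /word_eval big_cat. Qed.
Lemma h1_lift_scale a h : h1_lift g (h1_scale a h) = a *: h1_lift g h.
Proof.
rewrite h1_lift_of // /word_eval big_map scaler_sumr.
by apply: eq_bigr => p _; rewrite scalerA.
Qed.
Lemma h1_lift_opp h : h1_lift g (h1_opp h) = - h1_lift g h.
Proof. by rewrite h1_lift_scale scaleN1r. Qed.
Lemma h1_lift_mul h k : h1_lift g (h1_mul h k) = h1_lift g h * h1_lift g k.
Proof.
rewrite h1_lift_of // /word_eval big_allpairs_dep /h1_lift /word_eval mulr_suml.
apply: eq_bigr => p _; rewrite mulr_sumr; apply: eq_bigr => q _ /=.
by rewrite big_cat -scalerAl -scalerAr scalerA.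
Qed.
Definition h1_liftE := (h1_lift_gen, h1_lift_zero, h1_lift_one, h1_lift_add,
  h1_lift_scale, h1_lift_opp, h1_lift_mul).
End Lift.

Lemma h1_addA : associative h1_add.
Proof. by move=> *; apply: h1P => B g hg; rewrite !h1_liftE // addrA. Qed.
Lemma h1_addC : commutative h1_add.
Proof. by move=> *; apply: h1P => B g hg; rewrite !h1_liftE // addrC. Qed.
Lemma h1_add0 : left_id h1_zero h1_add.
Proof. by move=> *; apply: h1P => B g hg; rewrite !h1_liftE // add0r. Qed.
Lemma h1_addN : left_inverse h1_zero h1_opp h1_add.
Proof. by move=> *; apply: h1P => B g hg; rewrite !h1_liftE // addNr. Qed.
HB.instance Definition _ :=
  GRing.isZmodule.Build H1 h1_addA h1_addC h1_add0 h1_addN.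

Lemma h1_mulA : associative h1_mul.
Proof. by move=> *; apply: h1P => B g hg; rewrite !h1_liftE // mulrA. Qed.
Lemma h1_mul1l : left_id h1_one h1_mul.
Proof. by move=> *; apply: h1P => B g hg; rewrite !h1_liftE // mul1r. Qed.
Lemma h1_mul1r : right_id h1_one h1_mul.
Proof. by move=> *; apply: h1P => B g hg; rewrite !h1_liftE // mulr1. Qed.
Lemma h1_mulDl : left_distributive h1_mul h1_add.
Proof. by move=> *; apply: h1P => B g hg; rewrite !h1_liftE // mulrDl. Qed.
Lemma h1_mulDr : right_distributive h1_mul h1_add.
Proof. by move=> *; apply: h1P => B g hg; rewrite !h1_liftE // mulrDr. Qed.
Lemma h1_one_neq0 : h1_one != 0.
Proof.
apply/eqP => /(congr1 (h1_lift (fun _ : gen => 0 : K^o))).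
have hg : lie_relations (fun _ : gen => 0 : K^o).
  by split=> *; rewrite /commutator ?mulr0 ?subr0 ?mul0rn.
by rewrite !h1_liftE //; apply/eqP/oner_neq0.
Qed.
HB.instance Definition _ := GRing.Zmodule_isNzRing.Build H1
  h1_mulA h1_mul1l h1_mul1r h1_mulDl h1_mulDr h1_one_neq0.

Lemma h1_scaleA a b h : h1_scale a (h1_scale b h) = h1_scale (a * b) h.
Proof. by apply: h1P => B g hg; rewrite !h1_liftE // scalerA. Qed.
Lemma h1_scale1 : left_id 1 h1_scale.
Proof. by move=> h; apply: h1P => B g hg; rewrite !h1_liftE // scale1r. Qed.
Lemma h1_scaleDr : right_distributive h1_scale +%R.
Proof. by move=> *; apply: h1P => B g hg; rewrite !h1_liftE // scalerDr. Qed.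
Lemma h1_scaleDl h : {morph h1_scale^~ h : a b / a + b}.
Proof. by move=> *; apply: h1P => B g hg; rewrite !h1_liftE // scalerDl. Qed.
HB.instance Definition _ := GRing.Zmodule_isLmodule.Build K H1
  h1_scaleA h1_scale1 h1_scaleDr h1_scaleDl.

Lemma h1_scaleAl a (h k : H1) : a *: (h * k) = (a *: h) * k.
Proof. by apply: h1P => B g hg; rewrite !h1_liftE // scalerAl. Qed.
Lemma h1_scaleAr a (h k : H1) : a *: (h * k) = h * (a *: k).
Proof. by apply: h1P => B g hg; rewrite !h1_liftE // scalerAr. Qed.
HB.instance Definition _ := GRing.Lmodule_isLalgebra.Build K H1 h1_scaleAl.
HB.instance Definition _ := GRing.Lalgebra_isAlgebra.Build K H1 h1_scaleAr.

End EnvelopingAlgebra.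

Section CommutatorTheory.
Variable B : pzRingType.
Implicit Types x y z : B.

Lemma commutatorDr x y z :
  commutator x (y + z) = commutator x y + commutator x z.
Proof. by rewrite /commutator mulrDr mulrDl opprD addrACA. Qed.

Lemma commutatorDl x y z :
  commutator (x + y) z = commutator x z + commutator y z.
Proof. by rewrite /commutator mulrDr mulrDl opprD addrACA. Qed.

Lemma commutatorMn x y n : commutator x (y *+ n) = commutator x y *+ n.
Proof. by rewrite /commutator mulrnAr mulrnAl mulrnBl. Qed.

Lemma commutatorMr x y z :
  commutator x (y * z) = commutator x y * z + y * commutator x z.
Proof. by rewrite /commutator mulrBl mulrBr !mulrA addrA subrK. Qed.

Lemma commutatorBr x y z :
  commutator x (y - z) = commutator x y - commutator x z.
Proof.
by rewrite commutatorDr; congr (_ + _); rewrite /commutator mulrN mulNr opprD.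
Qed.

Lemma commutator_jacobi x y z :
  commutator x (commutator y z) =
  commutator (commutator x y) z + commutator y (commutator x z).
Proof.
rewrite {2}/commutator commutatorBr !commutatorMr opprD.
rewrite [X in _ + X]addrC addrACA.
by [].
Qed.

Lemma commutator_eq0 x y : x * y = y * x -> commutator x y = 0.
Proof. by rewrite /commutator => ->; rewrite subrr. Qed.

Lemma commutatorx1 x : commutator x 1 = 0.
Proof. by apply: commutator_eq0; rewrite mulr1 mul1r. Qed.

End CommutatorTheory.

Section Coproduct.
Variable K : fieldType.
Local Notation H := (H1 K).
Local Notation T := (tens H H).

Definition hX : H := h1_gen K GX.
Definition hY : H := h1_gen K GY.
(* As for [Gdelta], [hdelta 0] is delta_1. *)
Definition hdelta (n : nat) : H := h1_gen K (Gdelta n).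

Lemma h1_lift_commutator (B : algType K) (g : gen -> B) (h k : H) :
  lie_relations g ->
  h1_lift g (commutator h k) = commutator (h1_lift g h) (h1_lift g k).
Proof. by move=> hg; rewrite /commutator h1_lift_add // h1_lift_opp // !h1_lift_mul. Qed.

Lemma h1_liftMn (B : algType K) (g : gen -> B) (h : H) n :
  lie_relations g -> h1_lift g (h *+ n) = h1_lift g h *+ n.
Proof.
move=> hg; elim: n => [|n IH]; first by rewrite !mulr0n h1_liftE.
by rewrite !mulrS h1_liftE // IH.
Qed.

Lemma h1_gen_relations : lie_relations (h1_gen K).
Proof.
split=> *; apply: h1P => B g hg;
  rewrite h1_lift_commutator // ?h1_liftMn // !h1_liftE //.
- exact: lie_YX.
- exact: lie_Xdelta.
- exact: lie_Ydelta.
- exact: lie_deltadelta.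
Qed.

(* On delta_n with n >= 2 the coproduct is forced by
   delta_(n+1) = [X, delta_n]. *)
Definition DeltaX : T := pure hX 1 + pure 1 hX + pure (hdelta 0) hY.
Definition DeltaY : T := pure hY 1 + pure 1 hY.
Fixpoint Deltadelta (n : nat) : T :=
  match n with
  | 0 => pure (hdelta 0) 1 + pure 1 (hdelta 0)
  | n'.+1 => commutator DeltaX (Deltadelta n')
  end.

Definition Delta_gen (x : gen) : T :=
  match x with GX => DeltaX | GY => DeltaY | Gdelta n => Deltadelta n end.

Let commutator_pure1 (a b c : H) :
  commutator (pure a 1) (pure b c) = pure (commutator a b) c :> T.
Proof. by rewrite /commutator !pureM mul1r mulr1 linearBl. Qed.

Let commutator_pure2 (a b c : H) :
  commutator (pure 1 a) (pure b c) = pure b (commutator a c) :> T.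
Proof. by rewrite /commutator !pureM mul1r mulr1 linearBr. Qed.

(* A commutative subalgebra of the tensor square that is stable under
   [X, -] of the coproduct of X: it contains all coproducts of the delta_n,
   which therefore commute. *)
Inductive delta_poly : T -> Prop :=
| Dzero : delta_poly 0
| Dleft n : delta_poly (pure (hdelta n) 1)
| Dright n : delta_poly (pure 1 (hdelta n))
| Dadd s t : delta_poly s -> delta_poly t -> delta_poly (s + t)
| Dmul s t : delta_poly s -> delta_poly t -> delta_poly (s * t).

Let Dmuln t n : delta_poly t -> delta_poly (t *+ n).
Proof.
move=> ht; elim: n => [|n IH]; first exact: Dzero.
by rewrite mulrS; apply: Dadd.
Qed.

Let hdeltaC n m : hdelta n * hdelta m = hdelta m * hdelta n.
Proof. exact/subr0_eq/(lie_deltadelta h1_gen_relations). Qed.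

Lemma delta_poly_comm s t : delta_poly s -> delta_poly t -> s * t = t * s.
Proof.
move=> hs ht; elim: hs => {s} [|n|n|s s' _ IH _ IH'|s s' _ IH _ IH'].
- by rewrite mul0r mulr0.
- elim: ht => {t} [|m|m|t t' _ IH _ IH'|t t' _ IH _ IH'].
  + by rewrite mul0r mulr0.
  + by rewrite !pureM hdeltaC.
  + by rewrite !pureM !mul1r !mulr1.
  + by rewrite mulrDl mulrDr IH IH'.
  + by rewrite mulrA IH -mulrA IH' mulrA.
- elim: ht => {t} [|m|m|t t' _ IH _ IH'|t t' _ IH _ IH'].
  + by rewrite mul0r mulr0.
  + by rewrite !pureM !mul1r !mulr1.
  + by rewrite !pureM hdeltaC.
  + by rewrite mulrDl mulrDr IH IH'.
  + by rewrite mulrA IH -mulrA IH' mulrA.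
- by rewrite mulrDl mulrDr IH IH'.
- by rewrite -mulrA IH' mulrA IH mulrA.
Qed.

Lemma delta_poly_adX t : delta_poly t -> delta_poly (commutator DeltaX t).
Proof.
elim=> {t} [|n|n|s t _ IH _ IH'|s t hs IH ht IH'].
- by rewrite /commutator mul0r mulr0 subrr; apply: Dzero.
- rewrite !commutatorDl commutator_pure1 commutator_pure2.
  rewrite (lie_Xdelta h1_gen_relations) commutatorx1 linear0r addr0 [X in _ + X]commutator_eq0; last first.
    by rewrite !pureM hdeltaC mul1r mulr1.
  by rewrite addr0; apply: Dleft.
- rewrite !commutatorDl commutator_pure1 commutator_pure2.
  rewrite (lie_Xdelta h1_gen_relations) commutatorx1 linear0l add0r; apply: Dadd; first exact: Dright.
  have -> : commutator (pure (hdelta 0) hY) (pure 1 (hdelta n)) =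
            pure (hdelta 0) (commutator hY (hdelta n)).
    by rewrite /commutator !pureM mul1r mulr1 linearBr.
  rewrite (lie_Ydelta h1_gen_relations) linearMnr; apply: Dmuln.
  by have := Dmul (Dleft 0) (Dright n); rewrite pureM mulr1 mul1r.
- by rewrite commutatorDr; apply: Dadd.
- by rewrite commutatorMr; apply: Dadd; apply: Dmul.
Qed.

Lemma delta_poly_Deltadelta n : delta_poly (Deltadelta n).
Proof.
elim: n => [|n IH] /=; last exact: delta_poly_adX.
by apply: Dadd; [apply: Dleft | apply: Dright].
Qed.

Lemma Delta_YX : commutator DeltaY DeltaX = DeltaX.
Proof.
rewrite /DeltaX !commutatorDr !commutatorDl.
rewrite !commutator_pure1 !commutator_pure2.
rewrite (lie_YX h1_gen_relations) (lie_Ydelta h1_gen_relations) mulr1n.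
rewrite !commutatorx1 [commutator hY hY]commutator_eq0 //.
by rewrite !linear0l !linear0r ?add0r ?addr0.
Qed.

Lemma Delta_relations : lie_relations Delta_gen.
Proof.
split=> [|n|n|n m] /=; first exact: Delta_YX; first by [].
- elim: n => [|n IH] /=.
    rewrite !commutatorDr !commutatorDl !commutator_pure1 !commutator_pure2.
    rewrite (lie_Ydelta h1_gen_relations) mulr1n.
    rewrite !commutatorx1.
    by rewrite !linear0l !linear0r ?add0r ?addr0 mulr1n.
  by rewrite commutator_jacobi Delta_YX IH commutatorMn -mulrS.
- by apply: commutator_eq0; apply: delta_poly_comm;
     exact: delta_poly_Deltadelta.
Qed.

Definition Delta : H -> T := h1_lift Delta_gen.

Lemma Delta1 : Delta 1 = 1.
Proof. exact/h1_lift_one/Delta_relations. Qed.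
Lemma DeltaM h k : Delta (h * k) = Delta h * Delta k.
Proof. exact/h1_lift_mul/Delta_relations. Qed.
Lemma DeltaD h k : Delta (h + k) = Delta h + Delta k.
Proof. exact/h1_lift_add/Delta_relations. Qed.
Lemma DeltaZ a h : Delta (a *: h) = a *: Delta h.
Proof. exact/h1_lift_scale/Delta_relations. Qed.
Lemma Delta_hX : Delta hX = pure hX 1 + pure 1 hX + pure (hdelta 0) hY.
Proof. exact/(h1_lift_gen Delta_relations GX). Qed.
Lemma Delta_hY : Delta hY = pure hY 1 + pure 1 hY.
Proof. exact/(h1_lift_gen Delta_relations GY). Qed.
Lemma Delta_hdelta0 : Delta (hdelta 0) = pure (hdelta 0) 1 + pure 1 (hdelta 0).
Proof. exact/(h1_lift_gen Delta_relations (Gdelta 0)). Qed.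

Definition RC1 : T :=
  - pure hX (hY *+ 2) + pure (hY *+ 2) hX + pure (hdelta 0 * hY) (hY *+ 2).

End Coproduct.

(** An associative algebra is a vector space [A] with an associative bilinear
    product; it is not required to have a unit. *)
Section ModuleAlgebra.
Variables (K : fieldType) (A : lmodType K) (mul : {bilinear A -> A -> A}).

Section TensorAction.
Variable act : {bilinear H1 K -> A -> A}.

Definition pair_act (a b : A) (h k : H1 K) : A := mul (act h a) (act k b).

Lemma pair_act_bilinear a b : bilinear_for
  (GRing.Scale.Law.clone _ _ *:%R _) (GRing.Scale.Law.clone _ _ *:%R _)
  (pair_act a b).
Proof. by split=> u c x y; rewrite /pair_act linearPl ?linearPl ?linearPr. Qed.
HB.instance Definition _ a b :=
  bilinear_isBilinear.Build K (H1 K) (H1 K) A _ _ (pair_act a b) (pair_act_bilinear a b).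

(* (sum_i h_i (x) k_i) (a, b) = sum_i h_i(a) k_i(b) *)
Definition tens_act (t : tens (H1 K) (H1 K)) (a b : A) : A :=
  tens_lift (pair_act a b) t.

Lemma tens_act_pure h k a b :
  tens_act (pure h k) a b = mul (act h a) (act k b).
Proof. by rewrite /tens_act tens_lift_pure. Qed.

Lemma tens_act_linear a b : linear (fun t => tens_act t a b).
Proof. exact: (tens_lift_linear (pair_act a b)). Qed.

Lemma tens_act_bilinear t : bilinear_for
  (GRing.Scale.Law.clone _ _ *:%R _) (GRing.Scale.Law.clone _ _ *:%R _)
  (tens_act t).
Proof.
split=> u c x y; rewrite /tens_act /tens_lift /tsum /pair_act /= scaler_sumr -big_split /=;
  apply: eq_bigr => p _.
  by rewrite linearPr linearPl.
by rewrite !linearPr.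
Qed.
HB.instance Definition _ t :=
  bilinear_isBilinear.Build K A A A _ _ (tens_act t) (tens_act_bilinear t).

Lemma tens_act_RC1 a b :
  tens_act (RC1 K) a b =
  - mul (act (hX K) a) (act (hY K *+ 2) b)
  + mul (act (hY K *+ 2) a) (act (hX K) b)
  + mul (act (hdelta K 0 * hY K) a) (act (hY K *+ 2) b).
Proof.
by rewrite /tens_act /RC1 !linearD linearN /= !tens_lift_pure.
Qed.

(* [act_prod] is h(ab) = sum h_(1)(a) h_(2)(b). *)
Record module_algebra : Prop := ModuleAlgebra {
  act_one : forall a, act 1 a = a;
  act_mul : forall h k a, act (h * k) a = act h (act k a);
  act_prod : forall h a b, act h (mul a b) = tens_act (Delta h) a b }.

End TensorAction.

(* The Hochschild coboundary of a 2-cochain. *)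
Definition hochschild2 (P : A -> A -> A) (a b c : A) : A :=
  mul a (P b c) - P (mul a b) c + P a (mul b c) - mul (P a b) c.

(* [P] is a 2-cocycle, and half of its Gerstenhaber bracket with itself is a
   coboundary, so that the class of [P, P] vanishes. *)
Definition nc_poisson (P : {bilinear A -> A -> A}) : Prop :=
  (forall a b c, hochschild2 P a b c = 0) /\
  exists B : {bilinear A -> A -> A}, forall a b c,
    hochschild2 B a b c = P (P a b) c - P a (P b c).

End ModuleAlgebra.

(* Main.v *)
Require Import Defs.
From HB Require Import structures.
From mathcomp Require Import all_boot all_algebra sesquilinear.
From mathcomp Require Import boolp reals complex.

Set Implicit Arguments.
Unset Strict Implicit.
Unset Printing Implicit Defensive.

Import GRing.Theory.
Local Open Scope ring_scope.

(** Put [Z := X - delta_1 Y], which is [- S X].  Then [RC1] is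
    [2 (Y (x) X - Z (x) Y)], a cocycle because the failures of [X] and [Z] to be
    derivations, [delta_1 (x) Y] and [- Y (x) delta_1], cancel.  The candidate for
    [B] is the second Rankin-Cohen bracket of Connes and Moscovici.  Without a
    projective structure its coboundary differs from the associator of [RC1], but
    only by a tensor in [Y] and [V := 2 delta_2 - delta_1 ^ 2].  Both of these
    elements are primitive, hence act by derivations, and this makes the difference
    the coboundary of an explicit combination of the [V Y^i (x) Y^j]. *)

(** * Linear identities in abelian groups, by reflection *)

Inductive zmod_expr :=
| ZAtom of nat | Zzero | ZAdd of zmod_expr & zmod_expr
| ZOpp of zmod_expr | ZMuln of zmod_expr & nat.

Section ZmodReflection.
Variables (A : zmodType) (env : seq A).

Fixpoint zmod_eval (e : zmod_expr) : A :=
  match e with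
  | ZAtom i => env`_i
  | Zzero => 0
  | ZAdd e1 e2 => zmod_eval e1 + zmod_eval e2
  | ZOpp e1 => - zmod_eval e1
  | ZMuln e1 n => zmod_eval e1 *+ n
  end.

Fixpoint zmod_coef (e : zmod_expr) (i : nat) : int :=
  match e with
  | ZAtom j => (i == j)%:Z
  | Zzero => 0
  | ZAdd e1 e2 => zmod_coef e1 i + zmod_coef e2 i
  | ZOpp e1 => - zmod_coef e1 i
  | ZMuln e1 n => zmod_coef e1 i *+ n
  end.

Lemma zmod_evalE e :
  zmod_eval e = \sum_(i < size env) env`_i *~ zmod_coef e i.
Proof.
elim: e => [j||e1 IH1 e2 IH2|e1 IH1|e1 IH1 n] /=.
- case: (ltnP j (size env)) => [lt_j|le_j].
    rewrite (bigD1 (Ordinal lt_j)) //= eqxx big1 ?addr0 // => i /negPf ne_ij.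
    by rewrite -val_eqE /= in ne_ij; rewrite ne_ij.
  (* An index outside [env] evaluates to the default 0, and no term of the sum has that index. *)
  rewrite nth_default // big1 // => i _.
  by rewrite ltn_eqF // (leq_trans (ltn_ord i)).
- by rewrite big1.
- by rewrite IH1 IH2 -big_split; apply: eq_bigr => i _; rewrite mulrzDr.
- by rewrite IH1 -sumrN; apply: eq_bigr => i _; rewrite mulrNz.
- by rewrite IH1 -sumrMnl; apply: eq_bigr => i _; rewrite pmulrn -mulrzA pmulrn mulrzz.
Qed.

(** The premise is a closed computation on integers, so [vm_compute] decides it while [A] stays
    abstract. *)
Lemma zmod_eval_eq e1 e2 :
  all (fun i => zmod_coef e1 i == zmod_coef e2 i) (iota 0 (size env)) ->
  zmod_eval e1 = zmod_eval e2.
Proof.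
move=> /allP eq_e; rewrite !zmod_evalE; apply: eq_bigr => i _.
by rewrite (eqP (eq_e i _)) // mem_iota ltn_ord.
Qed.
End ZmodReflection.

Ltac zmod_index env x :=
  lazymatch env with
  | x :: _ => constr:(0%N)
  | _ :: ?env' => let i := zmod_index env' x in constr:(S i)
  end.

Ltac zmod_env env t :=
  lazymatch t with
  | ?u + ?v => let env' := zmod_env env u in zmod_env env' v
  | - ?u => zmod_env env u
  | ?u *+ _ => zmod_env env u
  | 0 => env
  (* For a new atom [zmod_index] fails at the end of [env], and backtracking selects the second
     branch. *)
  | _ => match env with
         | _ => let i := zmod_index env t in env
         | _ => constr:(t :: env)
         end
  end.

Ltac zmod_reify env t :=
  lazymatch t with
  | ?u + ?v => let e1 := zmod_reify env u in let e2 := zmod_reify env v in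
               constr:(ZAdd e1 e2)
  | - ?u => let e1 := zmod_reify env u in constr:(ZOpp e1)
  | ?u *+ ?n => let e1 := zmod_reify env u in constr:(ZMuln e1 n)
  | 0 => constr:(Zzero)
  | _ => let i := zmod_index env t in constr:(ZAtom i)
  end.

Ltac zmod :=
  lazymatch goal with
  | |- @eq ?A ?s ?t =>
    let env := zmod_env (@nil A) s in let env := zmod_env env t in
    let e1 := zmod_reify env s in let e2 := zmod_reify env t in
    change (zmod_eval env e1 = zmod_eval env e2);
    apply: zmod_eval_eq; vm_compute; reflexivity
  end.

(** * Hochschild coboundaries of cup products *)

Section Cochains.
Variables (K : fieldType) (A : lmodType K) (mul : {bilinear A -> A -> A}).
Hypothesis mulA : associative mul.

Definition cup (f g : A -> A) (a b : A) : A := mul (f a) (g b).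

Definition leibniz_defect (f : A -> A) (a b : A) : A :=
  f (mul a b) - mul (f a) b - mul a (f b).

(** As [leibniz_defect] is minus the coboundary of a 1-cochain, this is the graded Leibniz rule for
    the Hochschild differential. The product of [f a], [b] and [g c] occurs in both defect terms and
    cancels. *)
Lemma hochschild2_cup f g a b c :
  hochschild2 mul (cup f g) a b c =
  mul (f a) (leibniz_defect g b c) - mul (leibniz_defect f a b) (g c).
Proof.
rewrite /hochschild2 /leibniz_defect /cup !linearDr !linearDl /=.
rewrite !linearNr !linearNl /= !mulA; zmod.
Qed.

Lemma hochschild2D (f g : A -> A -> A) a b c :
  hochschild2 mul (fun x y => f x y + g x y) a b c =
  hochschild2 mul f a b c + hochschild2 mul g a b c.
Proof. by rewrite /hochschild2 linearDr linearDl /=; zmod. Qed.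

Lemma hochschild2Z k (f : A -> A -> A) a b c :
  hochschild2 mul (fun x y => k *: f x y) a b c = k *: hochschild2 mul f a b c.
Proof. by rewrite /hochschild2 linearZr linearZl /= !scalerBr scalerDr scalerBr. Qed.
End Cochains.

(* [zmod] compares atoms syntactically: these restatements fix the coercion path of
   [f], which the generic [raddfD] leaves to unification. *)
Lemma additiveE (K : fieldType) (A : lmodType K) (f : {additive A -> A}) :
  (forall u v, f (u + v) = f u + f v) * (forall u, f (- u) = - f u) *
  (forall u n, f (u *+ n) = f u *+ n).
Proof. by split; [split|] => *; rewrite (raddfD, raddfN, raddfMn). Qed.

Lemma bilinearE (K : fieldType) (A : lmodType K) (mul : {bilinear A -> A -> A}) :
  (forall u v w, mul (u + v) w = mul u w + mul v w) *
  (forall u v w, mul u (v + w) = mul u v + mul u w) *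
  (forall u v, mul (- u) v = - mul u v) * (forall u v, mul u (- v) = - mul u v) *
  (forall u v n, mul (u *+ n) v = mul u v *+ n) *
  (forall u v n, mul u (v *+ n) = mul u v *+ n).
Proof.
by do !split=> *;
   rewrite (linearDl, linearDr, linearNl, linearNr, linearMnl, linearMnr).
Qed.

(** * Rankin-Cohen brackets of operators, [D] and [E] standing for delta_1 and delta_2 *)

Section RankinCohen.
Variables (K : fieldType) (A : lmodType K) (mul : {bilinear A -> A -> A}).
Hypothesis mulA : associative mul.
Variables X Y Z D E V : {additive A -> A}.
Hypothesis YX : forall a, Y (X a) = X (Y a) + X a.
Hypothesis YD : forall a, Y (D a) = D (Y a) + D a.
Hypothesis XD : forall a, X (D a) = D (X a) + E a.
Hypothesis YM : forall a b, Y (mul a b) = mul (Y a) b + mul a (Y b).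
Hypothesis DM : forall a b, D (mul a b) = mul (D a) b + mul a (D b).
Hypothesis XM : forall a b,
  X (mul a b) = mul (X a) b + mul a (X b) + mul (D a) (Y b).
Hypothesis ZE : forall a, Z a = X a - D (Y a).
Hypothesis VE : forall a, V a = E a *+ 2 - D (D a).

Let mE := bilinearE mul.
Let XL := (additiveE X, XM).
Let YL := (additiveE Y, YM).
Let DL := (additiveE D, DM).

(** [E] is the commutator of [X] and [D]; the extra term [D (x) D] comes from [D (x) Y] in [XM]
    through [[Y, D] = D]. *)
Let EM a b : E (mul a b) = mul (E a) b + mul a (E b) + mul (D a) (D b).
Proof.
have EE u : E u = X (D u) - D (X u) by rewrite XD; zmod.
by rewrite !EE !(DL, XL) !mE YD !mE; zmod.
Qed.

(** The defect of [D \o D] is [2 D (x) D], twice that of [E]. *)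
Let VM a b : V (mul a b) = mul (V a) b + mul a (V b).
Proof. by rewrite !VE !(DL, EM) !mE; zmod. Qed.

Let ZM a b : Z (mul a b) = mul (Z a) b + mul a (Z b) - mul (Y a) (D b).
Proof. by rewrite !ZE !(XL, YL, DL) !mE; zmod. Qed.

Let YZ a : Y (Z a) = Z (Y a) + Z a.
Proof. by rewrite !ZE !YL YX YD; zmod. Qed.

Let ZD a : Z (D a) = D (Z a) + E a - D (D a).
Proof. by rewrite !ZE !YD XD !DL; zmod. Qed.
Let ZL := (additiveE Z, ZM).
Let VL := (additiveE V, VM).

Let U a := Y a *+ 2 + a.
Let Q a := Y (U a).

Definition rc1 a b := cup mul Y X a b *+ 2 - cup mul Z Y a b *+ 2.

(* The Connes-Moscovici bracket
   [S(X)^2 (x) Y(2Y+1) + S(X)(2Y+1) (x) X(2Y+1) + Y(2Y+1) (x) X^2]. *)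
Definition rc2 a b :=
  cup mul (Z \o Z) Q a b - cup mul (Z \o U) (X \o U) a b +
  cup mul Q (X \o X) a b.

Let defect_Y a b : leibniz_defect mul Y a b = 0.
Proof. by rewrite /leibniz_defect YM; zmod. Qed.

Let defect_X a b : leibniz_defect mul X a b = mul (D a) (Y b).
Proof. by rewrite /leibniz_defect XM; zmod. Qed.

Let defect_Z a b : leibniz_defect mul Z a b = - mul (Y a) (D b).
Proof. by rewrite /leibniz_defect ZM; zmod. Qed.

Let defect_V a b : leibniz_defect mul V a b = 0.
Proof. by rewrite /leibniz_defect VM; zmod. Qed.

Let defect_Q a b : leibniz_defect mul Q a b = mul (Y a) (Y b) *+ 4.
Proof. by rewrite /leibniz_defect /Q /U !YL !mE; zmod. Qed.

Let defect_XX a b : leibniz_defect mul (X \o X) a b =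
  mul (X a) (X b) *+ 2 + mul (D (X a)) (Y b) *+ 2 + mul (E a) (Y b) +
  mul (D a) (X (Y b)) *+ 2 + mul (D a) (X b) + mul (D (D a)) (Y (Y b)).
Proof. by rewrite /leibniz_defect /= !XL XD YX !mE; zmod. Qed.

Let defect_XU a b : leibniz_defect mul (X \o U) a b =
  (mul (X a) (Y b) + mul (D (Y a)) (Y b) + mul (Y a) (X b) +
   mul (D a) (Y (Y b))) *+ 2 + mul (D a) (Y b).
Proof. by rewrite /leibniz_defect /U /= !(YL, XL) !mE; zmod. Qed.

Let defect_ZZ a b : leibniz_defect mul (Z \o Z) a b =
  mul (Z a) (Z b) *+ 2 - mul (Z (Y a)) (D b) *+ 2 - mul (Z a) (D b) -
  mul (Y a) (D (Z b)) *+ 2 - mul (Y a) (E b) + mul (Y a) (D (D b)) +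
  mul (Y (Y a)) (D (D b)).
Proof. by rewrite /leibniz_defect /= !ZL YZ ZD !mE; zmod. Qed.

Let defect_ZU a b : leibniz_defect mul (Z \o U) a b =
  (mul (Z a) (Y b) + mul (Y a) (Z b) - mul (Y (Y a)) (D b) -
   mul (Y a) (D (Y b))) *+ 2 - mul (Y a) (D b).
Proof. by rewrite /leibniz_defect /U /= !(YL, ZL) !mE; zmod. Qed.

(** [Y (x) X] and [Z (x) Y] have the same coboundary [Y (x) D (x) Y]. *)
Lemma rc1_cocycle a b c : hochschild2 mul rc1 a b c = 0.
Proof.
have -> : hochschild2 mul rc1 a b c =
    hochschild2 mul (cup mul Y X) a b c *+ 2 -
    hochschild2 mul (cup mul Z Y) a b c *+ 2.
  by rewrite /hochschild2 /rc1 !mE; zmod.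
rewrite !hochschild2_cup // !(defect_X, defect_Y, defect_Z) !mE.
by rewrite !linear0r !linear0l mulA; zmod.
Qed.

(** [V] is twice the Schwarzian element [delta_2 - delta_1 ^ 2 / 2]; every term vanishes when [V]
    acts by zero. *)
Definition projective_obstruction a b c :=
  mul (mul (Y a) (V b)) (Y (Y c)) + mul (mul (Y a) (V b)) (Y c) +
  mul (mul (Y a) (V (Y b))) (Y c) *+ 2 + mul (mul (Y (Y a)) (V b)) (Y c).

(** Apart from the obstruction, this is second-order associativity of the product deformed by [rc1]
    and [rc2]. *)
Lemma hochschild2_rc2 a b c :
  hochschild2 mul rc2 a b c =
  rc1 (rc1 a b) c - rc1 a (rc1 b c) + projective_obstruction a b c.
Proof.
have -> : hochschild2 mul rc2 a b c =
    hochschild2 mul (cup mul (Z \o Z) Q) a b c -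
    hochschild2 mul (cup mul (Z \o U) (X \o U)) a b c +
    hochschild2 mul (cup mul Q (X \o X)) a b c.
  by rewrite /hochschild2 /rc2 !mE; zmod.
rewrite !hochschild2_cup // !(defect_XX, defect_XU, defect_ZZ, defect_ZU, defect_Q).
(* Normal form: words in [Z, Y] on [a], words ordered as [D, E, X, Y] on [b] and
   words ordered as [X, Y] on [c], so that [Z] is expanded on [b] only. *)
rewrite /rc1 /cup /Q /U /= !(YL, XL, ZL) !(ZE b, ZE (X b), ZE (Y b)).
rewrite /projective_obstruction !(YL, XL, DL) !VE !(XD, YD, YX, YZ) !(DL, XL, YL).
by rewrite !mE !mulA; zmod.
Qed.

(** The first three coboundaries give minus the obstruction, plus terms with [V] in the leftmost
    factor. The last two summands cancel these; 1/3 and 1/2 offset the factors 3 and 2 in the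
    defects of [Y ^ 3] and [Y ^ 2]. *)
Definition rc2_correction a b :=
  cup mul (V \o Y \o Y) Y a b + cup mul (V \o Y) (Y \o Y) a b +
  cup mul (V \o Y) Y a b +
  3%:R^-1 *: cup mul V (Y \o Y \o Y) a b + 2%:R^-1 *: cup mul V (Y \o Y) a b.

Let defect_YY a b : leibniz_defect mul (Y \o Y) a b = mul (Y a) (Y b) *+ 2.
Proof. by rewrite /leibniz_defect /= !YL; zmod. Qed.

Let defect_YYY a b : leibniz_defect mul (Y \o Y \o Y) a b =
  (mul (Y (Y a)) (Y b) + mul (Y a) (Y (Y b))) *+ 3.
Proof. by rewrite /leibniz_defect /= !YL; zmod. Qed.

Let defect_VY a b : leibniz_defect mul (V \o Y) a b = mul (V a) (Y b) + mul (Y a) (V b).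
Proof. by rewrite /leibniz_defect /= !(YL, VL); zmod. Qed.

Let defect_VYY a b : leibniz_defect mul (V \o Y \o Y) a b =
  mul (Y (Y a)) (V b) + mul (V (Y a)) (Y b) *+ 2 + mul (Y a) (V (Y b)) *+ 2 +
  mul (V a) (Y (Y b)).
Proof. by rewrite /leibniz_defect /= !(YL, VL); zmod. Qed.

Lemma hochschild2_rc2_correction a b c : 2%:R != 0 :> K -> 3%:R != 0 :> K ->
  hochschild2 mul rc2_correction a b c = - projective_obstruction a b c.
Proof.
move=> nz2 nz3.
(* Once the inverses are cancelled, all coefficients are integers, within reach of [zmod]. *)
have cancel_nat (n : nat) (v : A) : n%:R != 0 :> K -> n%:R^-1 *: (v *+ n) = v.
  by move=> nz; rewrite -scaler_nat scalerA mulVf // scale1r.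
rewrite !hochschild2D !hochschild2Z !hochschild2_cup //.
rewrite !(defect_VYY, defect_VY, defect_YYY, defect_YY, defect_V, defect_Y).
rewrite !linear0r !linear0l !subr0 !(linearMnr mul) !cancel_nat //= !mE !mulA.
by rewrite /projective_obstruction; zmod.
Qed.

Lemma hochschild2_rc2_corrected a b c : 2%:R != 0 :> K -> 3%:R != 0 :> K ->
  hochschild2 mul (fun x y => rc2 x y + rc2_correction x y) a b c =
  rc1 (rc1 a b) c - rc1 a (rc1 b c).
Proof.
move=> nz2 nz3.
by rewrite hochschild2D hochschild2_rc2 hochschild2_rc2_correction // addrK.
Qed.
End RankinCohen.

(** * Transfer to the action of the Hopf algebra *)

Section HopfAction.
Variables (K : fieldType) (A : lmodType K) (mul : {bilinear A -> A -> A}).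
Hypothesis mulA : associative mul.
Variable act : {bilinear H1 K -> A -> A}.
Hypothesis hact : module_algebra mul act.

Local Notation d1 := (hdelta K 0).
Local Notation d2 := (hdelta K 1).
Local Notation X := (hX K).
Local Notation Y := (hY K).

Definition hZ : H1 K := X - d1 * Y.
Definition hV : H1 K := d2 *+ 2 - d1 * d1.
Definition hU : H1 K := Y *+ 2 + 1.

(** Written as a tensor so that [tens_act] provides the bilinearity demanded of the witness [B]. *)
Definition RC2 : tens (H1 K) (H1 K) :=
  pure (hZ * hZ) (Y * hU) - pure (hZ * hU) (X * hU) + pure (Y * hU) (X * X) +
  (pure (hV * Y * Y) Y + pure (hV * Y) (Y * Y) + pure (hV * Y) Y +
   3%:R^-1 *: pure hV (Y * Y * Y) + 2%:R^-1 *: pure hV (Y * Y)).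

Let actM (h k : H1 K) a : act (h * k) a = act h (act k a).
Proof. exact: (act_mul hact). Qed.
Let actD (h k : H1 K) a : act (h + k) a = act h a + act k a.
Proof. exact: linearDl. Qed.
Let actN (h : H1 K) a : act (- h) a = - act h a. Proof. exact: linearNl. Qed.
Let actMn (h : H1 K) n a : act (h *+ n) a = act h a *+ n. Proof. exact: linearMnl. Qed.
Let act_commutator (h k : H1 K) a :
  act h (act k a) = act k (act h a) + act (commutator h k) a.
Proof. by rewrite -!actM -actD addrC subrK. Qed.

Let tens_actD s t a b :
  tens_act mul act (s + t) a b = tens_act mul act s a b + tens_act mul act t a b.
Proof. by rewrite /tens_act linearD. Qed.

Let tens_actN s a b : tens_act mul act (- s) a b = - tens_act mul act s a b.
Proof. by rewrite /tens_act linearN. Qed.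

Let tens_actZ k s a b : tens_act mul act (k *: s) a b = k *: tens_act mul act s a b.
Proof. by rewrite /tens_act linearZ. Qed.

Let act_hU a : act hU a = act Y a *+ 2 + a.
Proof. by rewrite /hU actD actMn (act_one hact). Qed.

Let act_hZ a : act hZ a = act X a - act d1 (act Y a).
Proof. by rewrite /hZ actD actN actM. Qed.

(** The terms [- X (x) 2Y] and [delta_1 Y (x) 2Y] combine into [- Z (x) 2Y]. *)
Lemma tens_act_RC1_rc1 a b :
  tens_act mul act (RC1 K) a b = rc1 mul (act X) (act Y) (act hZ) a b.
Proof.
rewrite tens_act_RC1 /rc1 /cup /= act_hZ actM !actMn.
by rewrite !(bilinearE mul); zmod.
Qed.

Lemma tens_act_RC2 a b :
  tens_act mul act RC2 a b =
  rc2 mul (act X) (act Y) (act hZ) a b + rc2_correction mul (act Y) (act hV) a b.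
Proof.
rewrite /RC2 !(tens_actD, tens_actN, tens_actZ) !tens_act_pure.
by rewrite !actM !act_hU.
Qed.

Lemma nc_poisson_RC1 : 2%:R != 0 :> K -> 3%:R != 0 :> K ->
  nc_poisson mul (tens_act mul act (RC1 K)).
Proof.
move=> nz2 nz3.
(* The brackets give the commutation rules of the operators, the coproducts their Leibniz rules. *)
have [relYX relXd relYd _] := h1_gen_relations K.
have YX a : act Y (act X a) = act X (act Y a) + act X a.
  by rewrite act_commutator relYX.
have YD a : act Y (act d1 a) = act d1 (act Y a) + act d1 a.
  by rewrite act_commutator relYd mulr1n.
have XD a : act X (act d1 a) = act d1 (act X a) + act d2 a.
  by rewrite act_commutator relXd.
have YM a b : act Y (mul a b) = mul (act Y a) b + mul a (act Y b).
  by rewrite (act_prod hact) Delta_hY tens_actD !tens_act_pure !(act_one hact).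
have DM a b : act d1 (mul a b) = mul (act d1 a) b + mul a (act d1 b).
  by rewrite (act_prod hact) Delta_hdelta0 tens_actD !tens_act_pure !(act_one hact).
have XM a b : act X (mul a b) =
    mul (act X a) b + mul a (act X b) + mul (act d1 a) (act Y b).
  by rewrite (act_prod hact) Delta_hX !tens_actD !tens_act_pure !(act_one hact).
have VE a : act hV a = act d2 a *+ 2 - act d1 (act d1 a).
  by rewrite /hV actD actN actMn actM.
split=> [a b c|].
  have := rc1_cocycle mulA YM DM XM act_hZ a b c.
  by rewrite /hochschild2 -!tens_act_RC1_rc1.
exists (tens_act mul act RC2) => a b c.
have := hochschild2_rc2_corrected mulA YX YD XD YM DM XM act_hZ VE a b c nz2 nz3.
by rewrite /hochschild2 -!tens_act_RC2 -!tens_act_RC1_rc1.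
Qed.
End HopfAction.

Theorem proposition6p1 (R : realType) (A : lmodType R[i])
    (mul : {bilinear A -> A -> A}) (mulA : associative mul)
    (act : {bilinear H1 R[i] -> A -> A}) (hact : module_algebra mul act) :
  nc_poisson mul (tens_act mul act (RC1 R[i])).
Proof. by apply: nc_poisson_RC1 => //; rewrite Num.Theory.pnatr_eq0. Qed.
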